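(* Let $p,q$ be positive integers with $\frac{\log p}{\log q}\notin\mathbb{Q}$. (1) For every rational $a\in\mathbb{T}$ there exists a finitely supported ergodic $\times p,\times q$-invariant measure $\nu$ on $\mathbb{T}$ such that $a$ is a generic point with respect to $\nu$. (2) Hence, for every ergodic $\times p,\times q$-invariant continuous measure $\mu$ on $\mathbb{T}$, there exists an irrational $x\in[0,1)$ such that $$\lim_{N\to\infty}\frac{1}{N^2}\sum_{i=0}^{N-1}\sum_{j=0}^{N-1}\delta_{p^iq^jx}=\mu$$ in the weak-$*$ topology.
   Context: $\mathbb{T}=\{z\in\mathbb{C}: |z|=1\}$ is the unit circle, identified with $[0,1)$ (equivalently $\mathbb{R}/\mathbb{Z}$) via $x\mapsto e(x)=\exp(2\pi i x)$. A measure always means a Borel probability measure; a measure on $\mathbb{T}$ amounts to a measure on $[0,1)$. A point $a\in\mathbb{T}$ is rational if $a=e(x)$ for some rational $x\in[0,1)$, and irrational otherwise. A measure $\mu$ on $\mathbb{T}$ is $\times p,\times q$-invariant if it is invariant under both maps $z\mapsto z^p$ and $z\mapsto z^q$; such a measure is ergodic if it is ergodic for the action of the semigroup $\mathbb{N}^2$ generated by these two commuting maps (every Borel set $A$ whose preimages under both maps equal $A$ has $\mu(A)\in\{0,1\}$). A measure $\mu$ is continuous (non-atomic) if $\mu\{z\}=0$ for every $z\in\mathbb{T}$. A point $a\in\mathbb{T}$ is generic with respect to an ergodic $\times p,\times q$-invariant measure $\mu$ if $\lim_{N\to\infty}\frac{1}{N^2}\sum_{i=0}^{N-1}\sum_{j=0}^{N-1}f(a^{p^iq^j})=\int_{\mathbb{T}}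 f\,d\mu$ for all continuous $f:\mathbb{T}\to\mathbb{C}$. $\delta_y$ is the Dirac measure concentrated at $y$, with $p^iq^jx$ taken modulo $1$. Weak-$*$ topology means convergence against all continuous functions on $\mathbb{T}$. *)

(* Defs.v *)
From HB Require Import structures.
From mathcomp Require Import all_boot all_order all_algebra complex.
From mathcomp Require Import all_classical all_reals all_analysis.

Set Implicit Arguments.
Unset Strict Implicit.
Unset Printing Implicit Defensive.

Import Order.TTheory GRing.Theory Num.Theory.
Import numFieldNormedType.Exports.
Import complex.

Local Open Scope classical_set_scope.
Local Open Scope ring_scope.
Local Open Scope complex_scope.

Section circle_type.
Variable R : realType.

Record circle := Circle { cval :> R[i]; circleP : `|cval| == 1 }.

HB.instance Definition _ := [isSub for cval].
HB.instance Definition _ := [Choice of circle by <:].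

Lemma circle1_subproof : `|1 : R[i]| == 1.
Proof. by rewrite normr1. Qed.

HB.instance Definition _ := isPointed.Build circle (Circle circle1_subproof).

(* The subspace topology; R[i]^o is the plane with the topology of the modulus. *)
HB.instance Definition _ :=
  Uniform.copy circle (initial_topology (cval : circle -> R[i]^o)).

HB.instance Definition _ :=
  Measurable.copy circle (g_sigma_algebraType (@open circle)).

Lemma cpow_subproof (n : nat) (z : circle) : `|cval z ^+ n| == 1.
Proof. by rewrite normrX (eqP (circleP z)) expr1n. Qed.

Definition cpow (n : nat) (z : circle) : circle := Circle (cpow_subproof n z).

Lemma cexp_subproof (x : R) :
  `|cos (2 * pi * x) +i* sin (2 * pi * x)| == 1.
Proof. by rewrite normc_def /= cos2Dsin2 sqrtr1. Qed.

Definition cexp (x : R) : circle := Circle (cexp_subproof x).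


Definition rational_point (a : circle) : Prop :=
  exists x : R, [/\ x \in `[0, 1[, rational x & a = cexp x].

(* R[i]-valued integrals are taken componentwise. *)
Definition cintegral (mu : {measure set circle -> \bar R}) (f : circle -> R[i])
  : R[i] :=
  (\int[mu]_z Re (f z)) +i* (\int[mu]_z Im (f z)).

Definition finitely_supported (mu : probability circle R) : Prop :=
  exists2 F : set circle, finite_set F & mu F = 1%E.

Definition continuous_measure (mu : probability circle R) : Prop :=
  forall z : circle, mu [set z] = 0%E.

Variables p q : nat.

Definition times_invariant (mu : probability circle R) : Prop :=
  forall A : set circle, measurable A ->
    mu (cpow p @^-1` A) = mu A /\ mu (cpow q @^-1` A) = mu A.

Definition times_ergodic (mu : probability circle R) : Prop :=
  forall A : set circle, measurable A ->
    cpow p @^-1` A = A -> cpow q @^-1` A = A -> mu A = 0%E \/ mu A = 1%E.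

Definition generic_point (a : circle) (mu : probability circle R) : Prop :=
  forall f : circle -> R[i]^o, continuous f ->
    ((N%:R ^+ 2)^-1 * \sum_(i < N) \sum_(j < N) f (cpow (p ^ i * q ^ j) a)
       : R[i]^o) @[N --> \oo] --> (cintegral mu f : R[i]^o).

(* N^-2 times the sum of the Dirac masses at e(p^i q^j x), i, j < N; it is the
   zero measure for N = 0. As e has period 1, it reduces p^i q^j x modulo 1. *)
Definition orbit_measure (x : R) (N : nat) : {measure set circle -> \bar R} :=
  mscale ((N%:R ^+ 2)^-1)%:nng
    (msum (fun i => msum (fun j => \d_(cexp ((p ^ i * q ^ j)%:R * x))) N) N).

End circle_type.

Definition weak_star_cvg (R : realType)
    (nu : nat -> {measure set (circle R) -> \bar R})
    (mu : {measure set (circle R) -> \bar R}) : Prop :=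
  forall f : circle R -> R[i]^o, continuous f ->
    (cintegral (nu N) f : R[i]^o) @[N --> \oo] --> (cintegral mu f : R[i]^o).

(* Main.v *)
Require Import Defs.
From HB Require Import structures.
From mathcomp Require Import all_boot all_order all_algebra complex.
From mathcomp Require Import all_classical all_reals all_analysis.
From mathcomp Require Import measurable_realfun.
From mathcomp Require Import ring lra.

Set Implicit Arguments.
Unset Strict Implicit.
Unset Printing Implicit Defensive.

Import Order.TTheory GRing.Theory Num.Theory.
Import numFieldNormedType.Exports.

Local Open Scope classical_set_scope.
Local Open Scope ring_scope.

(**
Two independent arguments prove the two halves.

For a rational point [a], say [a ^ n = 1], the point [a ^ (p^i q^j)] depends only
on the residues of [p^i] and [q^j] modulo [n], and each of these two sequences is
eventually periodic.  The averages over the squares [0, N)^2 therefore converge to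
the average over one box of periods, with an error of order 1/N
([double_sum_eventually_periodic]).  The measure [nu] is the normalised counting
measure of that box ([box_measure]).  Raising to the power [p] or [q] moves the box
by one step, which permutes its columns or its rows cyclically, so [nu] is
invariant.  It is ergodic because a set that equals both of its preimages contains
either every point of the orbit of [a] or none.

For a continuous ergodic measure [mu] it suffices that almost every point is
generic: the rational points are countable, hence null, so some irrational point is
generic too.  This is the pointwise ergodic theorem for averages over squares
([cvg_square_avg]), and it reduces to the maximal ergodic inequality for a single map
([maximal_ergodic]) as follows.  Write the average of [f] over a square as an average
along [sigma] of averages along [tau].  For N >= K it is at most the average along
[sigma] of h_K, the supremum over m >= K of the averages of length m along [tau].
The maximal inequality for [sigma] bounds the integral of the upper limit L of the
square averages by the integral of h_K; as K grows, h_K decreases to the upper limit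
of the averages along [tau], whose integral is at most that of [f] by the maximal
inequality for [tau].  Hence the integral of L is at most that of [f].  Since L is
exactly invariant under both maps, ergodicity makes L at most the integral of [f]
almost everywhere, and the same bound for [-f] gives convergence.

The exceptional null set depends on [f], so only countably many test functions may
be used.  Indicators of the arcs from 1 to a rational angle are enough, since every
continuous function on the circle is a uniform limit of their linear combinations
([arc_step_approximation]), and the ergodic theorem covers them because it is stated
for bounded measurable functions.
*)

(** * Maximal ergodic inequality for one map *)

Section bounded_integral.
Context d (T : measurableType d) (R : realType) (mu : probability T R).

Lemma bounded_integrable (f : T -> R) (B : R) : measurable_fun setT f ->
  (forall x, `|f x| <= B) -> mu.-integrable setT (EFin \o f).
Proof.
move=> mf fB; apply: measurable_bounded_integrable => //.
  by rewrite -ge0_fin_numE// fin_num_measure.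
exists B; split; first exact: num_real.
by move=> M BM x _ /=; rewrite (le_trans (fB x))// ltW.
Qed.

Lemma Rintegral_cst_probability (c : R) : (\int[mu]_x c = c)%R.
Proof. by rewrite Rintegral_cst//= [X in fine X](@probability_setT _ _ _ mu) mulr1. Qed.

Variables (tau : T -> T) (mtau : measurable_fun setT tau).
Hypothesis mu_tau : forall A, measurable A -> mu (tau @^-1` A) = mu A.

Lemma Rintegral_invariant (f : T -> R) (B : R) : measurable_fun setT f ->
  (forall x, `|f x| <= B) -> (\int[mu]_x f (tau x) = \int[mu]_x f x)%R.
Proof.
move=> mf fB; rewrite /Rintegral; congr fine.
rewrite -(@integral_pushforward _ _ _ _ _ _ mtau mu setT (EFin \o f))//.
- by apply: eq_measure_integral => A mA _; exact: mu_tau.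
- exact/measurable_EFinP.
- apply: (@bounded_integrable (f \o tau) B) => // [|x]; last exact: fB.
  exact: measurableT_comp.
Qed.

(** The maximum of the Birkhoff sums of length at most [N], the empty one included.
The recursion replaces a maximum over a range: both inequalities that the maximal
ergodic theorem needs are then read off one unfolding. *)
Fixpoint max_birkhoff_sum (g : T -> R) (N : nat) (x : T) : R :=
  if N is N'.+1 then Num.max 0 (g x + max_birkhoff_sum g N' (tau x)) else 0.

Local Notation u := max_birkhoff_sum.

Lemma max_birkhoff_sum_ge0 g N x : 0 <= u g N x.
Proof. by case: N => //= N; rewrite le_max lexx. Qed.

Lemma max_birkhoff_sum_homo g N x : u g N x <= u g N.+1 x.
Proof.
elim: N x => [|N IH] x; first by rewrite /= le_max lexx.
rewrite -[leRHS]/(Num.max 0 (g x + u g N.+1 (tau x))).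
rewrite -[leLHS]/(Num.max 0 (g x + u g N (tau x))).
rewrite ge_max !le_max lexx; apply/andP; split=> //.
by apply/orP; right; rewrite lerD2l; exact: IH.
Qed.

Lemma birkhoff_sum_le_max g n x :
  \sum_(k < n) g (iter k tau x) <= u g n x.
Proof.
elim: n x => [|n IH] x; first by rewrite big_ord0.
rewrite big_ord_recl /= le_max lerD2l; apply/orP; right.
apply: le_trans (IH (tau x)); apply: ler_sum => k _.
by rewrite -iterSr.
Qed.

Lemma measurable_max_birkhoff_sum g N : measurable_fun setT g ->
  measurable_fun setT (u g N).
Proof.
move=> mg; elim: N => [|N IH]; first exact: measurable_cst.
apply: measurable_maxr; first exact: measurable_cst.
apply: measurable_funD => //; exact: measurableT_comp.
Qed.

Lemma max_birkhoff_sum_bounded g B N x : (forall x, `|g x| <= B) ->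
  `|u g N x| <= N%:R * B.
Proof.
move=> gB; have B0 : 0 <= B by apply: le_trans (gB x).
rewrite ger0_norm ?max_birkhoff_sum_ge0//.
elim: N x => [|N IH] x; first by rewrite mul0r.
rewrite /= ge_max mulr_ge0//= -natr1 mulrDl mul1r addrC lerD//.
exact: le_trans (ler_norm _) (gB x).
Qed.

(** Garsia's argument.  Let [u] be [max_birkhoff_sum g N].  Where [u] is positive,
[u x = g x + u' (tau x) <= g x + u (tau x)], with [u'] the maximum for [N - 1];
where [u] vanishes, [u x - u (tau x) - B <= - B <= g x].  The integral of
[u - u \o tau] is zero, so the integral of [g] is at least [- B] times the measure
of the set where [u] vanishes.  By hypothesis these sets decrease to the empty set
as [N] grows. *)
Lemma maximal_ergodic (g : T -> R) (B : R) : measurable_fun setT g ->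
  (forall x, `|g x| <= B) ->
  (forall x, exists n, 0 < \sum_(k < n) g (iter k tau x)) ->
  0 <= \int[mu]_x g x.
Proof.
move=> mg gB gpos.
pose E N := [set x | u g N x <= 0].
have mu_ N : measurable_fun setT (u g N) by exact: measurable_max_birkhoff_sum.
have mE N : measurable (E N).
  rewrite (_ : E N = u g N @^-1` `]-oo, 0]).
    by rewrite -[X in measurable X]setTI; apply: mu_ => //; exact: measurable_itv.
  by apply/seteqP; split => x /=; rewrite in_itv.
have key N : - B * fine (mu (E N)) <= \int[mu]_x g x.
  have pw x : - B * \1_(E N) x + (u g N x - u g N (tau x)) <= g x.
    have gx : - B <= g x by move: (gB x); rewrite ler_norml => /andP[].
    rewrite indicE; have [u0|u0] := leP (u g N x) 0.
      rewrite mem_set//= mulr1.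
      have -> : u g N x = 0 by apply/eqP; rewrite eq_le u0 max_birkhoff_sum_ge0.
      rewrite sub0r; apply: le_trans gx.
      by rewrite gerDl oppr_le0 max_birkhoff_sum_ge0.
    rewrite memNset /=; last by rewrite /E /=; apply/negP; rewrite -ltNge.
    rewrite mulr0 add0r lerBlDr; case: N u0 => [|N]; first by rewrite ltxx.
    rewrite {1 2}/max_birkhoff_sum -/max_birkhoff_sum lt_max ltxx => u0.
    rewrite max_r ?(ltW u0)// lerD2l; exact: max_birkhoff_sum_homo.
  have m1 : measurable_fun setT (\1_(E N) : T -> R) by exact: measurable_indic.
  have i1 : mu.-integrable setT (EFin \o (\1_(E N) : T -> R)).
    apply: (@bounded_integrable _ 1) => // x.
    by rewrite indicE; case: (_ \in _); rewrite ?normr1 ?normr0.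
  have iu := bounded_integrable (mu_ N) (fun x => max_birkhoff_sum_bounded N x gB).
  have mut : measurable_fun setT (fun x => u g N (tau x)).
    exact: measurableT_comp (mu_ N) mtau.
  have iut := bounded_integrable mut (fun x => max_birkhoff_sum_bounded N (tau x) gB).
  have i1' : mu.-integrable setT (EFin \o (fun x => - B * (\1_(E N) : T -> R) x)).
    have := integrableZl measurableT (- B) i1.
    by apply: eq_integrable.
  have iud : mu.-integrable setT (EFin \o (fun x => u g N x - u g N (tau x))).
    have := integrableB measurableT iu iut.
    by apply: eq_integrable.
  have := @le_Rintegral _ _ _ mu setT
    (fun x => - B * \1_(E N) x + (u g N x - u g N (tau x))) g measurableT _
    (bounded_integrable mg gB) (fun x _ => pw x).
  rewrite RintegralD// RintegralB//.
  rewrite (Rintegral_invariant (mu_ N) (fun x => max_birkhoff_sum_bounded N x gB)).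
  rewrite subrr addr0.
  rewrite RintegralZl//.
  rewrite {1}/Rintegral integral_indic// setIT; apply.
  have := integrableD measurableT i1' iud.
  by apply: eq_integrable.
have E_cvg : (fine \o (mu \o E)) N @[N --> \oo] --> (0 : R).
  rewrite -[0]/(fine 0%:E); apply: fine_cvg.
  have <- : mu (\bigcap_N E N) = 0%:E.
    rewrite (_ : \bigcap_N E N = set0) ?measure0//.
    apply/seteqP; split => // x Ex; have [n] := gpos x.
    by rewrite ltNge (le_trans (birkhoff_sum_le_max _ _ _) (Ex n I)).
  apply: nonincreasing_cvg_mu => //.
  - by rewrite -ge0_fin_numE// fin_num_measure.
  - by apply: bigcap_measurable.
  - apply/nonincreasing_seqP => N; apply/subsetPset => x; rewrite /E /=.
    exact/le_trans/max_birkhoff_sum_homo.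
have : (- B * (fine \o (mu \o E)) N) @[N --> \oo] --> (- B * 0).
  by apply: cvgM => //; exact: cvg_cst.
rewrite mulr0 => /cvg_lim <- //.
apply: limr_le; last by apply: nearW => N; exact: key.
by apply: is_cvgM; [exact: is_cvg_cst|apply/cvg_ex; exists 0].
Qed.

(** When [F] is invariant, the Birkhoff sums of [f - F + e] are those of [f] minus
[n * (F - e)], so this is the maximal ergodic theorem for [f - F + e].  It is meant
for [F] an upper limit of averages: those of [f] itself, or of smaller functions. *)
Lemma le_invariant_integral (f F : T -> R) (B : R) :
  measurable_fun setT f -> measurable_fun setT F ->
  (forall x, `|f x| <= B) -> (forall x, `|F x| <= B) ->
  (forall x, F (tau x) = F x) ->
  (forall x e, 0 < e -> exists n,
     n%:R * (F x - e) < \sum_(k < n) f (iter k tau x)) ->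
  \int[mu]_x F x <= \int[mu]_x f x.
Proof.
move=> mf mF fB FB Finv Ff; apply/ler_addgt0Pr => e e0.
have Fiter k x : F (iter k tau x) = F x by elim: k => //= k; rewrite Finv.
have if_ := bounded_integrable mf fB.
have iF := bounded_integrable mF FB.
have ic : mu.-integrable setT (EFin \o (fun _ : T => e)).
  by apply: (@bounded_integrable _ `|e|) => //; exact: measurable_cst.
have iB : mu.-integrable setT (EFin \o (fun x => f x - F x)).
  by have := integrableB measurableT if_ iF; apply: eq_integrable.
rewrite -subr_ge0 -[e in leRHS]Rintegral_cst_probability addrAC -RintegralB//.
rewrite -RintegralD//; apply: (@maximal_ergodic _ (B + B + e)).
- by apply: measurable_funD => //; exact: measurable_funB.
- move=> x; rewrite (le_trans (ler_normD _ _))// (gtr0_norm e0) lerD2r.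
  by rewrite (le_trans (ler_normB _ _))// lerD.
move=> x; have [n Hn] := Ff x e e0; exists n.
under eq_bigr do rewrite Fiter -addrA.
rewrite big_split /= sumr_const card_ord -mulr_natl; move: Hn; lra.
Qed.

End bounded_integral.

(** * Upper limits of bounded sequences *)

Section limn_sup_bounded.
Variable R : realType.
Implicit Types (u v : R^nat) (B c : R).

Lemma bounded_fun_of_le u B : (forall n, `|u n| <= B) -> bounded_fun u.
Proof.
move=> uB; exists B; split; first exact: num_real.
by move=> M BM n _ /=; rewrite (le_trans (uB n))// ltW.
Qed.

Lemma lt_limn_sup u B c : (forall n, `|u n| <= B) -> c < limn_sup u ->
  forall K, exists2 n, (K <= n)%N & c < u n.
Proof.
move=> /bounded_fun_of_le ub; rewrite limn_supE// => cu K.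
have : c < sups u K.
  apply: lt_le_trans cu _; apply: ge_inf; last by exists K.
  exact: bounded_fun_has_lbound_sups.
move=> /sup_gt; case; first by exists (u K) => /=; exists K => /=.
by move=> _ [n /= Kn <-] cun; exists n.
Qed.

Lemma le_sups u B K n : (forall n, `|u n| <= B) -> (K <= n)%N -> u n <= sups u K.
Proof.
move=> /bounded_fun_of_le ub Kn; apply: ub_le_sup; last by exists n.
exact/has_ubound_sdrop/bounded_fun_has_ubound.
Qed.

Lemma limn_sup_lt u B c : (forall n, `|u n| <= B) -> limn_sup u < c ->
  \forall n \near \oo, u n < c.
Proof.
move=> uB; rewrite limn_supE; last exact: bounded_fun_of_le uB.
move=> /inf_lt; case; first by exists (sups u 0) => /=; exists 0%N.
move=> _ [K _ <-] uK; exists K => // n /= Kn.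
exact: le_lt_trans (le_sups uB Kn) uK.
Qed.

Lemma sups_bounded u B K : (forall n, `|u n| <= B) -> `|sups u K| <= B.
Proof.
move=> uB; rewrite ler_norml; apply/andP; split.
  apply: le_trans (le_sups uB (leqnn K)).
  by have := uB K; rewrite ler_norml => /andP[].
apply: ge_sup; first by exists (u K); exists K => /=.
by move=> _ [n _ <-]; exact: le_trans (ler_norm _) (uB n).
Qed.

Lemma cvg_sups_limn_sup u B : (forall n, `|u n| <= B) ->
  sups u K @[K --> \oo] --> limn_sup u.
Proof.
move=> /bounded_fun_of_le ub; rewrite limn_supE//; apply: cvg_sups_inf.
  exact: bounded_fun_has_ubound.
exact: bounded_fun_has_lbound.
Qed.

Lemma limn_sup_bounded u B : (forall n, `|u n| <= B) -> `|limn_sup u| <= B.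
Proof.
move=> uB; have c := cvg_sups_limn_sup uB.
rewrite -(cvg_lim _ (cvg_norm c))//; apply: limr_le.
  by apply/cvg_ex; eexists; exact: cvg_norm c.
by apply: nearW => K; exact: sups_bounded.
Qed.

Lemma eq_limn_sup u v B : (forall n, `|u n| <= B) -> (forall n, `|v n| <= B) ->
  (u n - v n) @[n --> \oo] --> (0 : R) -> limn_sup u = limn_sup v.
Proof.
have le_ (w z : R^nat) : (forall n, `|w n| <= B) -> (forall n, `|z n| <= B) ->
    (w n - z n) @[n --> \oo] --> (0 : R) -> limn_sup w <= limn_sup z.
  move=> wB zB wz; have -> : w = z \+ (fun n => w n - z n).
    by apply/funext => n /=; rewrite addrC subrK.
  apply: le_trans (le_limn_supD _ _) _.
  - exact: bounded_fun_of_le zB.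
  - apply: (@bounded_fun_of_le _ (B + B)) => n.
    by rewrite (le_trans (ler_normB _ _))// lerD.
  - by have [_ ->] := cvg_limn_inf_sup wz; rewrite addr0.
move=> uB vB uv; apply/eqP; rewrite eq_le !le_//.
rewrite (_ : (fun n => _) = - (fun n => u n - v n)).
  by rewrite -oppr0; exact: cvgN.
by apply/funext => n; rewrite fctE opprB.
Qed.

(** The bound is asked for positive [n] only: an average over an empty range is [0],
which need not be near its limit. *)
Lemma cvg_le_harmonic u C : (forall n, (0 < n)%N -> `|u n| <= C / n%:R) ->
  u n @[n --> \oo] --> (0 : R).
Proof.
move=> uC; apply/norm_cvg0P.
have C0 : C / n%:R @[n --> \oo] --> (0 : R).
  rewrite -[0](mulr0 C); apply: cvgM; first exact: cvg_cst.
  apply/cvgrPdist_lt => e e0; near=> n.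
  have n0 : 0 < n%:R :> R by rewrite ltr0n; near: n; exists 1%N.
  rewrite sub0r normrN gtr0_norm ?invr_gt0// invf_plt ?posrE//.
  near: n; exact: nbhs_infty_gtr.
apply: (squeeze_cvgr _ _ C0); last exact: cvg_cst.
by near=> n; rewrite normr_ge0 uC//; near: n; exists 1%N.
Unshelve. all: by end_near. Qed.

End limn_sup_bounded.

(** * Birkhoff averages *)

Section birkhoff_average.
Context {T : Type} {R : realType}.
Implicit Types (tau : T -> T) (f g : T -> R).

Definition birkhoff_avg tau f (N : nat) (x : T) : R :=
  N%:R^-1 * \sum_(k < N) f (iter k tau x).

Lemma birkhoff_avg_bounded tau f B N x : (forall y, `|f y| <= B) ->
  `|birkhoff_avg tau f N x| <= B.
Proof.
move=> fB; have B0 : 0 <= B by apply: le_trans (fB x).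
case: N => [|N]; first by rewrite /birkhoff_avg big_ord0 mulr0 normr0.
rewrite /birkhoff_avg normrM gtr0_norm ?invr_gt0 ?ltr0n//.
rewrite ler_pdivrMl ?ltr0n// (le_trans (ler_norm_sum _ _ _))//.
apply: le_trans (ler_sum _ (fun (i : 'I_N.+1) _ => fB (iter i tau x))) _.
by rewrite sumr_const card_ord mulr_natl.
Qed.

(** The two sums differ only in their first and last terms. *)
Lemma birkhoff_avg_shift tau f B N x : (forall y, `|f y| <= B) ->
  `|birkhoff_avg tau f N (tau x) - birkhoff_avg tau f N x| <= (B + B) / N%:R.
Proof.
move=> fB; case: N => [|N].
  by rewrite /birkhoff_avg !big_ord0 !mulr0 subrr normr0 invr0 mulr0.
rewrite /birkhoff_avg -mulrBr normrM gtr0_norm ?invr_gt0 ?ltr0n// mulrC.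
rewrite ler_pM2r ?invr_gt0 ?ltr0n//.
rewrite big_ord_recr big_ord_recl /= -iterSr.
under eq_bigr do rewrite -iterSr.
rewrite (addrC (f x)) opprD addrACA subrr add0r.
by rewrite (le_trans (ler_normB _ _))// lerD.
Qed.

Lemma birkhoff_avgB tau f g N x : birkhoff_avg tau (fun y => f y - g y) N x =
  birkhoff_avg tau f N x - birkhoff_avg tau g N x.
Proof. by rewrite /birkhoff_avg sumrB mulrBr. Qed.

Lemma birkhoff_avgN tau f N x :
  birkhoff_avg tau (fun y => - f y) N x = - birkhoff_avg tau f N x.
Proof. by rewrite /birkhoff_avg sumrN mulrN. Qed.

Lemma birkhoff_avg_comm sigma tau f N x :
  (forall y, sigma (tau y) = tau (sigma y)) ->
  birkhoff_avg sigma f N (tau x) = birkhoff_avg sigma (f \o tau) N x.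
Proof.
move=> st; rewrite /birkhoff_avg; congr (_ * _); apply: eq_bigr => k _ /=.
by congr f; elim: (k : nat) => //= n ->.
Qed.

End birkhoff_average.

(** * Pointwise ergodic theorem for squares *)

Section square_ergodic_theorem.
Context d (T : measurableType d) (R : realType) (mu : probability T R).
Variables sigma tau : T -> T.
Hypotheses (msigma : measurable_fun setT sigma) (mtau : measurable_fun setT tau).
Hypothesis mu_sigma : forall A, measurable A -> mu (sigma @^-1` A) = mu A.
Hypothesis mu_tau : forall A, measurable A -> mu (tau @^-1` A) = mu A.
Hypothesis comm_sigma_tau : forall x, sigma (tau x) = tau (sigma x).
Hypothesis erg : forall A, measurable A -> sigma @^-1` A = A ->
  tau @^-1` A = A -> mu A = 0%E \/ mu A = 1%E.

Lemma measurable_birkhoff_avg (g : T -> R) (rho : T -> T) N :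
  measurable_fun setT rho -> measurable_fun setT g ->
  measurable_fun setT (birkhoff_avg rho g N).
Proof.
move=> mrho mg; apply: measurable_funM; first exact: measurable_cst.
apply: measurable_sum => k.
apply: (@measurableT_comp _ _ _ _ _ _ g) => //.
by elim: (k : nat) => [|n IH]; [exact: measurable_id|exact: measurableT_comp mrho IH].
Qed.

(** The average over the square [0, N)^2, nested so that a one-dimensional inequality
applies in each direction separately. *)
Definition square_avg (f : T -> R) (N : nat) : T -> R :=
  birkhoff_avg sigma (birkhoff_avg tau f N) N.

Section limsup.
Variables (f : T -> R) (B : R).
Hypotheses (mf : measurable_fun setT f) (fB : forall x, `|f x| <= B).

Let avgB N x : `|birkhoff_avg tau f N x| <= B.
Proof. exact: birkhoff_avg_bounded. Qed.

Let avg2B N x : `|square_avg f N x| <= B.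
Proof. exact: birkhoff_avg_bounded. Qed.

Let has_bounds (h : (T -> R)^nat) : (forall N x, `|h N x| <= B) ->
  (forall x, setT x -> has_ubound (range (h ^~ x))) /\
  (forall x, setT x -> has_lbound (range (h ^~ x))).
Proof.
move=> hB; split => x _; have /bounded_fun_of_le hb := hB ^~ x.
  exact: bounded_fun_has_ubound.
exact: bounded_fun_has_lbound.
Qed.

Let upper x := limn_sup (square_avg f ^~ x).

Let mupper : measurable_fun setT upper.
Proof.
have [hu hl] := has_bounds avg2B; apply: measurable_fun_limn_sup => // n.
by do 2 apply: measurable_birkhoff_avg => //.
Qed.

Lemma limsup_square_avg_sigma x : upper (sigma x) = upper x.
Proof.
apply: (@eq_limn_sup _ _ _ B) => //; apply: (@cvg_le_harmonic _ _ (B + B)) => n _.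
exact: birkhoff_avg_shift.
Qed.

(** Here [tau] passes through the outer average by commutation, and the shift is
then absorbed by the inner averages, uniformly in the point. *)
Lemma limsup_square_avg_tau x : upper (tau x) = upper x.
Proof.
apply: (@eq_limn_sup _ _ _ B) => //; apply: (@cvg_le_harmonic _ _ (B + B)) => n _.
rewrite /square_avg birkhoff_avg_comm// -birkhoff_avgB.
by apply: birkhoff_avg_bounded => y; exact: birkhoff_avg_shift.
Qed.

(** The suprema [h K] of the tails of the inner averages decouple the two directions:
for [n >= K] the square average at [x] is at most the average of length [n] of [h K]
along [sigma].  The maximal inequality is used for [sigma] and [h K], then, after
[K] has gone to infinity by dominated convergence, for [tau] and [f]. *)
Lemma Rintegral_limsup_square_avg_le : \int[mu]_x upper x <= \int[mu]_x f x.
Proof.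
pose h K x := sups (birkhoff_avg tau f ^~ x) K.
pose F x := limn_sup (birkhoff_avg tau f ^~ x).
have hB K x : `|h K x| <= B by exact: sups_bounded.
have FB x : `|F x| <= B by exact: limn_sup_bounded.
have [hu hl] := has_bounds avgB.
have mh K : measurable_fun setT (h K).
  by apply: measurable_fun_sups => // n; exact: measurable_birkhoff_avg.
have mF : measurable_fun setT F.
  by apply: measurable_fun_limn_sup => // n; exact: measurable_birkhoff_avg.
have upper_h K : \int[mu]_x upper x <= \int[mu]_x h K x.
  apply: (le_invariant_integral msigma mu_sigma (mh K) mupper (hB K) (B := B)).
  - by move=> x; exact: limn_sup_bounded.
  - exact: limsup_square_avg_sigma.
  move=> x e e0; have ux : upper x - e < upper x by rewrite gtrBl.
  (* [K.+1] rather than [K], so that [n] is also positive. *)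
  have [n Kn un] := lt_limn_sup (avg2B ^~ x) ux K.+1; exists n.
  have n0 : 0 < n%:R :> R by rewrite ltr0n (leq_trans _ Kn).
  move: un; rewrite /square_avg /birkhoff_avg ltr_pdivlMl//.
  move=> /lt_le_trans; apply; apply: ler_sum => i _.
  exact: (le_sups (avgB ^~ (iter i sigma x)) (ltnW Kn)).
have F_f : \int[mu]_x F x <= \int[mu]_x f x.
  apply: (le_invariant_integral mtau mu_tau mf mF fB FB).
    move=> x; apply: (@eq_limn_sup _ _ _ B) => //.
    by apply: (@cvg_le_harmonic _ _ (B + B)) => n _; exact: birkhoff_avg_shift.
  move=> x e e0; have ux : F x - e < F x by rewrite gtrBl.
  have [n n1] := lt_limn_sup (avgB ^~ x) ux 1; exists n.
  by rewrite -ltr_pdivlMl// ltr0n.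
apply: le_trans F_f.
have h_F : \int[mu]_x h K x @[K --> \oo] --> \int[mu]_x F x.
  apply: fine_cvg; rewrite fineK; last first.
    by apply: integrable_fin_num => //; exact: bounded_integrable _ mF FB.
  apply: (@dominated_cvg _ _ _ mu setT measurableT _ _ (fun=> B%:E)) => //.
  - by move=> K; exact/measurable_EFinP.
  - by move=> x _; apply: cvg_EFin;
      [exact: nearW|exact: cvg_sups_limn_sup (avgB ^~ x)].
  - by apply: (@bounded_integrable _ _ _ mu (fun=> B) `|B|).
  - by move=> K x _; rewrite /= lee_fin.
rewrite -(cvg_lim _ h_F)//; apply: limr_ge; first by apply/cvg_ex; eexists; exact: h_F.
exact: nearW.
Qed.

(** Each set where the upper limit exceeds [\int f + 1/(n+1)] equals its preimages, so
it has measure 0 or 1; measure 1 would contradict the bound on the integral. *)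
Lemma limsup_square_avg_le :
  {ae mu, forall x, limn_sup (square_avg f ^~ x) <= \int[mu]_x f x}.
Proof.
set c := \int[mu]_x f x.
have Hn n : {ae mu, forall x, upper x <= c + n.+1%:R^-1}.
  pose A := [set x | c + n.+1%:R^-1 < upper x].
  have mA : measurable A.
    rewrite (_ : A = upper @^-1` `]c + n.+1%:R^-1, +oo[).
      by rewrite -[X in measurable X]setTI; apply: mupper => //; exact: measurable_itv.
    by apply/seteqP; split => x /=; rewrite in_itv /= andbT.
  have Asigma : sigma @^-1` A = A.
    by apply/seteqP; split => x; rewrite /A /= limsup_square_avg_sigma.
  have Atau : tau @^-1` A = A.
    by apply/seteqP; split => x; rewrite /A /= limsup_square_avg_tau.
  have [A0|A1] := erg mA Asigma Atau.
    by exists A; split => // x /=; rewrite /A /= => /negP; rewrite -ltNge.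
  exfalso.
  have : c + n.+1%:R^-1 <= c.
    apply: le_trans Rintegral_limsup_square_avg_le.
    have nA : mu (~` A) = 0%E by rewrite probability_setC// A1 subee.
    have restr g : mu.-integrable setT (EFin \o g) ->
        \int[mu]_x g x = \int[mu]_(x in A) g x.
      move=> ig; rewrite /Rintegral.
      by rewrite (negligible_integral (measurableC mA) measurableT ig nA) setTD setCK.
    rewrite -[leLHS](Rintegral_cst_probability mu).
    have iu : mu.-integrable setT (EFin \o upper).
      by apply: (bounded_integrable _ mupper (B := B)) => x; exact: limn_sup_bounded.
    have ic : mu.-integrable setT (EFin \o (fun _ : T => c + n.+1%:R^-1)).
      exact: (@bounded_integrable _ _ _ mu _ `|c + n.+1%:R^-1|).
    rewrite !restr//; apply: le_Rintegral => //.
    - by apply: integrableS ic.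
    - by apply: integrableS iu.
    - by move=> x; exact: ltW.
  by rewrite gerDl leNgt invr_gt0 ltr0n.
apply: filterS (ae_foralln Hn) => x xn.
apply/ler_addgt0Pr => e e0.
have [n ne] : exists n, n.+1%:R^-1 < e.
  exists (Num.trunc e^-1); rewrite invf_plt ?posrE//.
  exact: truncnS_gt.
by apply: le_trans (xn n) _; rewrite lerD2l ltW.
Qed.

End limsup.

(** Two one-sided bounds: one on the upper limit for [f] and, through [- f], one on the
lower limit. *)
Theorem cvg_square_avg (f : T -> R) (B : R) : measurable_fun setT f ->
  (forall x, `|f x| <= B) ->
  {ae mu, forall x, square_avg f N x @[N --> \oo] --> \int[mu]_x f x}.
Proof.
move=> mf fB.
have fB' x : `|- f x| <= B by rewrite normrN.
have up := limsup_square_avg_le mf fB.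
have low := limsup_square_avg_le (measurable_funN mf) fB'.
apply: filterS2 up low => x ux lx.
have avgN N : square_avg (fun y => - f y) N x = - square_avg f N x.
  rewrite /square_avg -birkhoff_avgN; congr birkhoff_avg.
  by apply/funext => y; rewrite birkhoff_avgN.
have intN : \int[mu]_x (- f x) = - \int[mu]_x f x.
  rewrite -[RHS]mulN1r -RintegralZl//; last exact: bounded_integrable _ mf fB.
  by apply: eq_Rintegral => y _; rewrite mulN1r.
apply/cvgrPdist_lt => e e0.
have h1 : \forall N \near \oo, square_avg f N x < \int[mu]_x f x + e.
  apply: (@limn_sup_lt _ _ B).
    by move=> n; do 2 apply: birkhoff_avg_bounded => ?.
  by apply: le_lt_trans ux _; rewrite ltrDl.
have h2 : \forall N \near \oo,
    square_avg (fun y => - f y) N x < - (\int[mu]_x f x) + e.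
  apply: (@limn_sup_lt _ _ B).
    by move=> n; do 2 apply: birkhoff_avg_bounded => ?.
  by rewrite -intN; apply: le_lt_trans lx _; rewrite ltrDl.
near=> N; rewrite ltr_norml.
have H1 : square_avg f N x < \int[mu]_x f x + e by near: N.
have : square_avg (fun y => - f y) N x < - (\int[mu]_x f x) + e by near: N.
rewrite avgN => H2; apply/andP; split; lra.
Unshelve. all: by end_near. Qed.

End square_ergodic_theorem.

(** * Topology and Borel sets of the circle *)

Lemma exprn_continuous_numField (K : numFieldType) n :
  continuous (fun u : K^o => u ^+ n : K^o).
Proof.
elim: n => [|n IH] u.
  exact: (@cst_continuous K^o K^o 1 u).
rewrite (_ : (fun v : K^o => _) = (id : K^o -> K^o) \* (fun v => v ^+ n)); last first.
  by apply/funext => v; rewrite exprS.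
by apply: continuousM; [exact: cvg_id|exact: IH].
Qed.

Section complex_plane.
Variable R : realType.
Import complex.
Local Open Scope complex_scope.

Lemma complex_gt0_Re (e : R[i]) : 0 < e -> 0 < Re e /\ e = (Re e)%:C.
Proof. by case: e => a b; rewrite ltcE /= => /andP[/eqP -> ->]. Qed.

Lemma normc_le (x y : R) : `|x +i* y| <= (`|x| + `|y|)%:C.
Proof.
rewrite normc_def lecR /= -(ger0_norm (addr_ge0 (normr_ge0 x) (normr_ge0 y))).
rewrite -sqrtr_sqr ler_wsqrtr// sqrrD !real_normK ?num_real//.
by rewrite lerD2r lerDl mulrn_wge0// mulr_ge0.
Qed.

Lemma normc_ge_Im (z : R[i]) : `|Im z|%:C <= `|z|.
Proof. by rewrite normc_def lecR -sqrtr_sqr ler_wsqrtr// lerDr sqr_ge0. Qed.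

Lemma cvg_complex I (F : set_system I) (FF : Filter F) (a b : I -> R) (la lb : R) :
  a @ F --> la -> b @ F --> lb ->
  (a t +i* b t : R[i]^o) @[t --> F] --> (la +i* lb : R[i]^o).
Proof.
move=> /cvgrPdist_lt al /cvgrPdist_lt bl; apply/cvgrPdist_lt => ec /complex_gt0_Re [+ ->].
move: (Re ec) => e e0.
have e2 : 0 < e / 2 by rewrite divr_gt0.
apply: filterS2 (al _ e2) (bl _ e2) => t at_ bt.
apply: le_lt_trans (normc_le (la - a t) (lb - b t)) _.
by rewrite ltcR (splitr e) ltrD.
Qed.

Lemma continuous_Re : continuous (@Re R : R[i]^o -> R).
Proof.
move=> z; apply/(@cvgrPdist_lt _ _ _ _ (nbhs_filter (z : R[i]^o))) => e e0.
have ec : 0 < e%:C :> R[i] by rewrite ltcR.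
have : \forall w \near (z : R[i]^o), `|z - w| < e%:C.
  by apply/nbhs_normP; exists e%:C.
apply: filterS => w zw; rewrite -ltcR; apply: le_lt_trans zw.
have -> : Re z - Re w = Re (z - w) by case: z => ? ?; case: w.
exact: normc_ge_Re.
Qed.

Lemma continuous_Im : continuous (@Im R : R[i]^o -> R).
Proof.
move=> z; apply/(@cvgrPdist_lt _ _ _ _ (nbhs_filter (z : R[i]^o))) => e e0.
have ec : 0 < e%:C :> R[i] by rewrite ltcR.
have : \forall w \near (z : R[i]^o), `|z - w| < e%:C.
  by apply/nbhs_normP; exists e%:C.
apply: filterS => w zw; rewrite -ltcR; apply: le_lt_trans zw.
have -> : Im z - Im w = Im (z - w) by case: z => ? ?; case: w.
exact: normc_ge_Im.
Qed.

End complex_plane.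

Section circle_topology.
Variable R : realType.
Import complex.
Local Open Scope complex_scope.
Local Notation circle := (circle R).

Lemma continuous_cval : continuous (@cval R : circle -> R[i]^o).
Proof. exact: initial_continuous. Qed.

Lemma continuous_to_circle (X : topologicalType) (h : X -> circle) :
  continuous ((@cval R \o h) : X -> R[i]^o) -> continuous h.
Proof. by move=> ch; exact: continuous_comp_initial. Qed.

Lemma circle_hausdorff : hausdorff_space circle.
Proof.
move=> z w zw; apply: val_inj => /=.
apply: (@norm_hausdorff _ R[i]^o) => A B zA wB.
have [t [At Bt]] := zw _ _ (continuous_cval zA) (continuous_cval wB).
by exists (cval t).
Qed.

Lemma continuous_cpow n : continuous (@cpow R n).
Proof.
apply: continuous_to_circle => z.
exact: cvg_comp (@continuous_cval z) (@exprn_continuous_numField R[i] n (cval z)).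
Qed.

Lemma continuous_cexp : continuous (@cexp R).
Proof.
apply: continuous_to_circle => x.
have lin : 2 * pi * y @[y --> x] --> 2 * pi * x.
  by apply: cvgM; [exact: cvg_cst|exact: cvg_id].
apply: cvg_complex.
  exact: (cvg_comp _ _ lin (@continuous_cos R _)).
exact: (cvg_comp _ _ lin (@continuous_sin R _)).
Qed.

Lemma open_circle_measurable (A : set circle) : open A -> measurable A.
Proof. by move=> oA; exact: sub_sigma_algebra. Qed.

Lemma closed_circle_measurable (A : set circle) : closed A -> measurable A.
Proof.
move=> /closed_openC oA; rewrite -[A]setCK; apply: measurableC.
exact: open_circle_measurable.
Qed.

Lemma measurable_circle_set1 (z : circle) : measurable [set z].
Proof.
apply: closed_circle_measurable; apply: compact_closed; first exact: circle_hausdorff.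
exact: compact_set1.
Qed.

Lemma measurable_cpow n : measurable_fun setT (@cpow R n).
Proof.
apply: (@measurability _ _ _ _ _ _ (@open circle)) => //.
move=> _ [A oA <-]; rewrite setTI; apply: open_circle_measurable.
by move/continuousP : (@continuous_cpow n); apply.
Qed.

Lemma continuous_circle_measurable (f : circle -> R) : continuous f ->
  measurable_fun setT f.
Proof.
move=> /continuousP cf; apply: (measurability _ (RGenOpens.measurableE R)) => //.
by move=> _ [_ [a [b ->] <-]]; rewrite setTI; apply: open_circle_measurable; exact: cf.
Qed.

(** The angle is [acos] of the real part on the upper half circle, and its reflection
on the lower one. *)
Lemma cexp_surj (z : circle) : exists2 x : R, x \in `[0, 1[ & z = cexp x.
Proof.
case: z => -[a b] zP; have ab : a ^+ 2 + b ^+ 2 = 1.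
  have := eqP zP; rewrite normc_def /= => /(congr1 (fun u => Re u ^+ 2)) /=.
  by rewrite expr1n sqr_sqrtr// addr_ge0// sqr_ge0.
have a11 : -1 <= a <= 1 by apply/andP; split; nra.
have ca : cos (acos a) = a by apply: acosK; rewrite in_itv.
have sa : sin (acos a) = `|b|.
  rewrite sin_acos// -sqrtr_sqr; congr Num.sqrt; lra.
have pi0 := pi_gt0 R.
have tpi : 2 * pi != 0 :> R by rewrite mulf_neq0// gt_eqF.
have [b0|b0] := leP 0 b.
  exists (acos a / (2 * pi)).
    rewrite in_itv /= divr_ge0 ?(acos_ge0 a11) ?mulr_ge0 ?(ltW pi0)//=.
    rewrite ltr_pdivrMr ?mulr_gt0// mul1r.
    by apply: le_lt_trans (acos_lepi a11) _; rewrite ltr_pMl// ltr1n.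
  by apply: val_inj => /=; rewrite mulrC divfK// ca sa ger0_norm.
exists (1 - acos a / (2 * pi)).
  have a1 : -1 <= a < 1 by nra.
  rewrite in_itv /= ltrBlDr ltrDl divr_gt0 ?acos_gt0 ?mulr_gt0// andbT.
  rewrite subr_ge0 ler_pdivrMr ?mulr_gt0// mul1r.
  by apply: le_trans (acos_lepi a11) _; rewrite ler_pMl// ler1n.
apply: val_inj => /=; rewrite mulrBr mulr1 (mulrC _ (_ / _)) divfK//.
have -> : 2 * pi = pi *+ 2 :> R by rewrite mulr_natl.
by rewrite cosB sinB cos2pi sin2pi !mul1r !mul0r addr0 add0r ca sa ltr0_norm// opprK.
Qed.

Lemma cpow_cexp n x : cpow n (cexp x) = cexp (n%:R * x) :> circle.
Proof.
apply: val_inj => /=; elim: n => [|n IH].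
  by rewrite expr0 mul0r mulr0 cos0 sin0.
rewrite exprS IH.
have -> : 2 * pi * (n.+1%:R * x) = 2 * pi * x + 2 * pi * (n%:R * x).
  by rewrite -[n.+1%:R]natr1; ring.
rewrite cosD sinD.
by apply/eqP; rewrite eq_complex /=; apply/andP; split; apply/eqP; ring.
Qed.

Lemma cpowM m n (z : circle) : cpow m (cpow n z) = cpow (n * m) z.
Proof. by apply: val_inj => /=; rewrite exprM. Qed.

End circle_topology.

(** * Integrals against averages of Dirac masses *)

Section dirac_average.
Context d (T : measurableType d) (R : realType).

Lemma Rintegral_dirac_average (r : {nonneg R}) (z : nat -> nat -> T) (M N : nat)
    (g : T -> R) : measurable_fun setT g ->
  \int[mscale r (msum (fun i => msum (fun j => \d_(z i j)) N) M)]_x g x =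
  r%:num * \sum_(i < M) \sum_(j < N) g (z i j).
Proof.
move=> mg; rewrite /Rintegral.
have ge0 (h : T -> R) : measurable_fun setT h -> (forall x, 0 <= h x) ->
    (\int[mscale r (msum (fun i => msum (fun j => \d_(z i j)) N) M)]_x (h x)%:E)%E =
    (r%:num * \sum_(i < M) \sum_(j < N) h (z i j))%:E.
  move=> mh h0; have mEh : measurable_fun setT (EFin \o h) by exact/measurable_EFinP.
  rewrite ge0_integral_mscale//; last by move=> x _; rewrite lee_fin.
  rewrite EFinM; congr (_ * _)%E.
  rewrite ge0_integral_measure_sum//; last by move=> x _; rewrite lee_fin.
  rewrite -sumEFin; apply: eq_bigr => i _.
  rewrite ge0_integral_measure_sum//; last by move=> x _; rewrite lee_fin.
  rewrite -sumEFin; apply: eq_bigr => j _.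
  by rewrite integral_dirac// diracT mul1e.
rewrite -[fun x => (g x)%:E]/(EFin \o g) integralE funerpos funerneg.
have mp : measurable_fun setT (g ^\+)%R by exact: measurable_funrpos.
have mn : measurable_fun setT (g ^\-)%R by exact: measurable_funrneg.
rewrite !ge0// /= -mulrBr; congr (_ * _).
rewrite -sumrB; apply: eq_bigr => i _; rewrite -sumrB; apply: eq_bigr => j _.
by rewrite -[in RHS](funrposBneg g).
Qed.

End dirac_average.

(** * Functions averaging to their integral *)

Section square_average_limits.
Context d (T : measurableType d) (R : realType) (mu : probability T R).
Variables (sigma tau : T -> T) (x : T).
Local Notation avg := (square_avg sigma tau).

(** Boundedness belongs to the notion so that it passes to linear combinations and to
uniform limits, where the integrals have to exist. *)
Definition averages_to_integral (g : T -> R) :=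
  [/\ measurable_fun setT g, exists B, forall y, `|g y| <= B &
      avg g N x @[N --> \oo] --> \int[mu]_y g y].

Lemma birkhoff_avg_lin rho (c : R) (f g : T -> R) N y :
  birkhoff_avg rho (fun y => c * f y + g y) N y =
  c * birkhoff_avg rho f N y + birkhoff_avg rho g N y.
Proof. by rewrite /birkhoff_avg big_split /= mulrDr -mulr_sumr mulrCA. Qed.

Lemma square_avg_lin (c : R) (f g : T -> R) N y :
  avg (fun y => c * f y + g y) N y = c * avg f N y + avg g N y.
Proof.
rewrite /square_avg -birkhoff_avg_lin; congr birkhoff_avg.
by apply/funext => u; exact: birkhoff_avg_lin.
Qed.

Lemma averages_to_integral_lin (c : R) (f g : T -> R) :
  averages_to_integral f -> averages_to_integral g ->
  averages_to_integral (fun y => c * f y + g y).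
Proof.
move=> [mf [B fB] cf] [mg [C gC] cg].
have icf : mu.-integrable setT (EFin \o (fun y => c * f y)).
  apply: (@bounded_integrable _ _ _ mu _ (`|c| * B)); first exact: measurable_funM.
  by move=> y; rewrite normrM ler_wpM2l.
split.
- by apply: measurable_funD => //; exact: measurable_funM.
- exists (`|c| * B + C) => y; rewrite (le_trans (ler_normD _ _))// lerD//.
  by rewrite normrM ler_wpM2l.
under eq_fun do rewrite square_avg_lin.
rewrite RintegralD//; last exact: bounded_integrable mg gC.
rewrite RintegralZl//; last exact: bounded_integrable mf fB.
by apply: cvgD => //; apply: cvgM => //; exact: cvg_cst.
Qed.

Lemma averages_to_integral0 : averages_to_integral (fun=> 0).
Proof.
split; [exact: measurable_cst|by exists 0 => y; rewrite normr0|].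
rewrite Rintegral_cst_probability.
rewrite (_ : (fun N => _) = (fun=> 0)); first exact: cvg_cst.
apply/funext => N; apply/eqP; rewrite -normr_le0.
by do 2 apply: birkhoff_avg_bounded => ?; rewrite normr0.
Qed.

Lemma averages_to_integral_sum (n : nat) (c : nat -> R) (g : nat -> T -> R) :
  (forall k, averages_to_integral (g k)) ->
  averages_to_integral (fun y => \sum_(k < n) c k * g k y).
Proof.
move=> gk; elim: n => [|n IH].
  by under eq_fun do rewrite big_ord0; exact: averages_to_integral0.
under eq_fun do rewrite big_ord_recr /= addrC.
exact: averages_to_integral_lin.
Qed.

Lemma averages_to_integral_approx (g : T -> R) : measurable_fun setT g ->
  (forall e, 0 < e -> exists s, averages_to_integral s /\
     forall y, `|g y - s y| <= e) ->
  averages_to_integral g.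
Proof.
move=> mg H.
have [B gB] : exists B, forall y, `|g y| <= B.
  have [s [[_ [C sC] _] gs]] := H 1 ltr01; exists (1 + C) => y.
  by rewrite -[g y](subrK (s y)) (le_trans (ler_normD _ _))// lerD.
split=> //; first by exists B.
apply/cvgrPdist_le => e e0; have e3 : 0 < e / 3 by rewrite divr_gt0.
have [s [[ms [C sC] cs] gs]] := H _ e3.
have avg_gs N : `|avg g N x - avg s N x| <= e / 3.
  have -> : avg g N x - avg s N x = avg (fun y => g y - s y) N x.
    rewrite /square_avg -birkhoff_avgB; congr birkhoff_avg.
    by apply/funext => y; rewrite birkhoff_avgB.
  by do 2 apply: birkhoff_avg_bounded => ?.
have int_gs : `|\int[mu]_y g y - \int[mu]_y s y| <= e / 3.
  have ig := bounded_integrable mu mg gB; have is_ := bounded_integrable mu ms sC.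
  rewrite -RintegralB//; have mgs := measurable_funB mg ms.
  apply: le_trans (le_normr_Rintegral _ _) _ => //.
    exact: (bounded_integrable mu mgs gs).
  rewrite -[leRHS](Rintegral_cst_probability mu); apply: le_Rintegral => //.
  - apply: (@bounded_integrable _ _ _ mu _ (e / 3)); first exact: measurableT_comp.
    by move=> y; rewrite normr_id.
  - exact: (@bounded_integrable _ _ _ mu _ `|e / 3|).
move/cvgrPdist_le : cs => /(_ _ e3); apply: filterS => N sN.
have := avg_gs N; move: int_gs sN; rewrite !ler_norml; move: e3; clear; lra.
Qed.

End square_average_limits.

(** * Approximation by indicators of arcs *)

Section arcs.
Variable R : realType.
Local Notation circle := (circle R).

(** Closed segments have compact, hence Borel, images.  The shift by one makes [arc m 0] empty, so that the
differences of consecutive arcs partition the whole circle, the point 1 included. *)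
Definition arc (m k : nat) : set circle :=
  @cexp R @` `[0, (k%:R - 1) / m.+1%:R].

Lemma measurable_arc m k : measurable (arc m k).
Proof.
apply: closed_circle_measurable; apply: compact_closed; first exact: circle_hausdorff.
apply: continuous_compact; last exact: segment_compact.
by apply: continuous_subspaceT; exact: continuous_cexp.
Qed.

Lemma arc_homo m k : arc m k `<=` arc m k.+1.
Proof.
move=> _ [t /= + <-]; rewrite in_itv /= => /andP[t0 tk].
exists t => //=; rewrite in_itv /= t0 (le_trans tk)//.
by rewrite ler_pM2r ?invr_gt0 ?ltr0n// lerD2r ler_nat.
Qed.

Lemma arc0 m : arc m 0 = set0.
Proof.
apply/seteqP; split => // _ [t /= + _]; rewrite in_itv /= => /andP[t0 tk].
suff : (0%:R - 1) / m.+1%:R < 0 :> R by rewrite ltNge (le_trans t0 tk).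
by rewrite pmulr_llt0 ?invr_gt0 ?ltr0n// sub0r ltrN10.
Qed.

Lemma arcT m : arc m m.+2 = setT.
Proof.
apply/seteqP; split => // z _; have [t + ->] := cexp_surj z.
rewrite in_itv /= => /andP[t0 t1]; exists t => //=.
by rewrite in_itv /= t0 -[m.+2%:R]natr1 addrK divff ?ltW// pnatr_eq0.
Qed.

(** Compactness in its near-covering form: a property of [(m, x)] that holds for large
[m] locally uniformly in [x] holds for large [m] on all of the segment.  The point
[y] may leave the segment, which spares a discussion of its ends. *)
Lemma uniform_continuity_unit_interval (h : R -> R) (e : R) : continuous h -> 0 < e ->
  exists m, forall x y, 0 <= x <= 1 -> `|x - y| <= m.+1%:R^-1 -> `|h x - h y| <= e.
Proof.
move=> ch e0; have e2 : 0 < e / 2 by rewrite divr_gt0.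
have /compact_near_coveringP K := @segment_compact R 0 1.
pose P m x := forall y, `|x - y| <= m.+1%:R^-1 -> `|h x - h y| <= e.
have : \forall m \near \oo, `[0, 1]%classic `<=` P m.
  apply: K => x _; have /cvgrPdist_lt/(_ _ e2) := ch x.
  move=> /nbhs_normP[r /= r0 rh].
  have r2 : 0 < r / 2 by rewrite divr_gt0.
  exists (ball x (r / 2), [set m | m.+1%:R^-1 < r / 2]); first split.
  - exact: nbhsx_ballx.
  - near=> m => /=; rewrite invf_plt ?posrE//.
    rewrite -[m.+1%:R]natr1; apply: (@lt_trans _ _ m%:R); last by rewrite ltrDl.
    by near: m; exact: nbhs_infty_gtr.
  move=> [x' m] /= [xx' mr] y x'y.
  have hx' : `|h x - h x'| < e / 2.
    by apply: rh; rewrite /= (lt_trans xx')// ltr_pdivrMr// ltr_pMr// ltr1n.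
  have hy : `|h x - h y| < e / 2.
    apply: rh => /=; rewrite -(subrK x' x) -addrA (le_lt_trans (ler_normD _ _))//.
    by rewrite (splitr r) ltrD// (le_lt_trans x'y).
  rewrite -(subrK (h x) (h x')) -addrA (le_trans (ler_normD _ _))//.
  by rewrite (splitr e) lerD ?ltW// distrC.
move=> [m _ /(_ m (leqnn m)) mP]; exists m => x y x01; apply: mP => /=.
by rewrite in_itv.
Unshelve. all: by end_near. Qed.

(** The differences [w k] of consecutive indicators are nonnegative and sum to 1, and
where [w k] does not vanish the point has an angle within [1/(m+1)] of [k/(m+1)].
So [g z] and the step function are averages, with the same weights, of values that
differ by at most [e]. *)
Lemma arc_step_approximation (g : circle -> R) (e : R) : continuous g -> 0 < e ->
  exists m (c : nat -> R), forall z,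
    `|g z - \sum_(k < m.+2) c k * (\1_(arc m k.+1) z - \1_(arc m k) z)| <= e.
Proof.
move=> cg e0; pose h := g \o @cexp R.
have ch : continuous h.
  by move=> x; apply: continuous_comp; [exact: continuous_cexp|exact: cg].
have [m hm] := uniform_continuity_unit_interval ch e0.
exists m, (fun k => h (k%:R / m.+1%:R)) => z.
pose w k : R := \1_(arc m k.+1) z - \1_(arc m k) z.
have sum_w : \sum_(k < m.+2) w k = 1.
  rewrite -(big_mkord xpredT w) telescope_sumr//.
  by rewrite arc0 arcT !indicE in_set0 in_setT subr0.
have w0 k : 0 <= w k.
  rewrite /w !indicE subr_ge0 ler_nat.
  by case: (boolP (z \in arc m k)) => // /set_mem/arc_homo/mem_set ->.
have sum_cst (a : R) : a = \sum_(k < m.+2) a * w k.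
  by rewrite -mulr_sumr sum_w mulr1.
rewrite [g z]sum_cst [leRHS]sum_cst -sumrB.
apply: le_trans (ler_norm_sum _ _ _) _; apply: ler_sum => k _.
rewrite -/(w k) -mulrBl normrM (ger0_norm (w0 k)).
have [wk|] := eqVneq (w k) 0; first by rewrite wk !mulr0.
move=> wk; apply: ler_wpM2r => //.
have : z \notin arc m k /\ z \in arc m k.+1.
  move: wk; rewrite /w !indicE.
  case: (boolP (z \in arc m k)) => [/set_mem/arc_homo/mem_set ->|_].
    by rewrite subrr eqxx.
  by case: (z \in _) => //; rewrite subrr eqxx.
move=> [zk /set_mem[t + tz]]; rewrite /= in_itv /= -[k.+1%:R]natr1 addrK => /andP[t0 tk].
have m0 : 0 < m.+1%:R :> R by rewrite ltr0n.
have kt : (k%:R - 1) / m.+1%:R < t.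
  rewrite ltNge; apply/negP => tk'; move/negP: zk; apply; apply/mem_set.
  by exists t => //=; rewrite in_itv /= t0.
rewrite -tz distrC; apply: (hm (k%:R / m.+1%:R) t).
  rewrite divr_ge0// ler_pdivrMr// mul1r ler_nat.
  by rewrite -ltnS ltn_ord.
rewrite ger0_norm ?subr_ge0// lerBlDr -lerBlDl.
by move: (ltW kt); rewrite mulrBl mul1r.
Qed.

End arcs.

(** * Generic points of ergodic measures *)

Section generic_points.
Variable R : realType.
Import complex.
Local Open Scope complex_scope.
Local Notation circle := (circle R).
Implicit Types (p q : nat) (a : circle) (mu : probability circle R).

Lemma iter_cpow p i a : iter i (@cpow R p) a = cpow (p ^ i) a.
Proof.
elim: i => [|i IH] /=; first by apply: val_inj; rewrite /= expn0 expr1.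
by rewrite IH cpowM expnSr.
Qed.

Lemma iter_cpow2 p q i j a :
  iter j (@cpow R q) (iter i (@cpow R p) a) = cpow (p ^ i * q ^ j) a.
Proof. by rewrite !iter_cpow cpowM. Qed.

Lemma square_avg_cpow p q (g : circle -> R) N a :
  square_avg (@cpow R p) (@cpow R q) g N a =
  (N%:R ^+ 2)^-1 * \sum_(i < N) \sum_(j < N) g (cpow (p ^ i * q ^ j) a).
Proof.
rewrite /square_avg /birkhoff_avg -mulr_sumr mulrA -invfM; congr (_ * _).
by apply: eq_bigr => i _; apply: eq_bigr => j _; rewrite iter_cpow2.
Qed.

Lemma sum_complexE n (F : 'I_n -> R[i]) :
  \sum_(i < n) F i = (\sum_(i < n) Re (F i)) +i* (\sum_(i < n) Im (F i)).
Proof.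
elim: n F => [|n IH] F; first by rewrite !big_ord0.
by rewrite !big_ord_recr /= IH; case: (F ord_max).
Qed.

Lemma complex_square_avgE p q (f : circle -> R[i]) N a :
  (N%:R ^+ 2)^-1 * \sum_(i < N) \sum_(j < N) f (cpow (p ^ i * q ^ j) a) =
  square_avg (@cpow R p) (@cpow R q) (@Re R \o f) N a +i*
  square_avg (@cpow R p) (@cpow R q) (@Im R \o f) N a.
Proof.
have -> : ((N%:R : R[i]) ^+ 2)^-1 = ((N%:R ^+ 2)^-1 : R)%:C.
  by rewrite fmorphV rmorphXn rmorph_nat.
rewrite !square_avg_cpow sum_complexE.
set r := (_ ^+ 2)^-1; rewrite -[r%:C]/(r +i* 0).
apply/eqP; rewrite eq_complex /= !mul0r subr0 addr0; apply/andP.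
by split; apply/eqP; congr (_ * _); apply: eq_bigr => i _; rewrite sum_complexE.
Qed.

Lemma generic_point_real p q a mu :
  (forall g : circle -> R, continuous g ->
    square_avg (@cpow R p) (@cpow R q) g N a @[N --> \oo] --> \int[mu]_z g z) ->
  generic_point p q a mu.
Proof.
move=> H f cf; under eq_fun do rewrite complex_square_avgE.
have cRe : continuous (@Re R \o f).
  by move=> z; apply: continuous_comp; [exact: cf|exact: continuous_Re].
have cIm : continuous (@Im R \o f).
  by move=> z; apply: continuous_comp; [exact: cf|exact: continuous_Im].
exact: cvg_complex (H _ cRe) (H _ cIm).
Qed.

Lemma cintegral_orbit_measure p q x N (f : circle -> R[i]^o) : continuous f ->
  cintegral (orbit_measure p q x N) f =
  (N%:R ^+ 2)^-1 * \sum_(i < N) \sum_(j < N) f (cpow (p ^ i * q ^ j) (cexp x)).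
Proof.
move=> cf; rewrite complex_square_avgE !square_avg_cpow /cintegral /orbit_measure.
rewrite !Rintegral_dirac_average /=.
- congr (_ +i* _); congr (_ * _); apply: eq_bigr => i _; apply: eq_bigr => j _;
    by rewrite cpow_cexp.
- apply: continuous_circle_measurable => z.
  by apply: continuous_comp; [exact: cf|exact: continuous_Im].
- apply: continuous_circle_measurable => z.
  by apply: continuous_comp; [exact: cf|exact: continuous_Re].
Qed.

Lemma generic_point_weak_star p q x mu :
  generic_point p q (cexp x) mu -> weak_star_cvg (orbit_measure p q x) mu.
Proof.
move=> gen f cf; under eq_fun do rewrite cintegral_orbit_measure//.
exact: gen.
Qed.

(** This reduces genericity, a condition on uncountably many test functions, to a
countable one. *)
Lemma generic_point_arcs p q a mu :
  (forall m k, averages_to_integral mu (@cpow R p) (@cpow R q) a (\1_(arc m k))) ->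
  generic_point p q a mu.
Proof.
move=> H; apply: generic_point_real => g cg.
suff [] : averages_to_integral mu (@cpow R p) (@cpow R q) a g by [].
apply: averages_to_integral_approx; first exact: continuous_circle_measurable.
move=> e e0; have [m [c gc]] := arc_step_approximation cg e0.
exists (fun z => \sum_(k < m.+2) c k * (\1_(arc m k.+1) z - \1_(arc m k) z)).
split=> //; apply: (@averages_to_integral_sum _ _ _ _ _ _ _ m.+2 c
  (fun k z => \1_(arc m k.+1) z - \1_(arc m k) z)) => k.
under eq_fun do rewrite addrC -mulN1r.
exact: averages_to_integral_lin.
Qed.

Lemma ae_generic_point p q mu : times_invariant p q mu -> times_ergodic p q mu ->
  {ae mu, forall a, generic_point p q a mu}.
Proof.
move=> inv erg.
have H m k : {ae mu, forall a,
    averages_to_integral mu (@cpow R p) (@cpow R q) a (\1_(arc m k))}.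
  have mi : measurable_fun setT (\1_(arc m k) : circle -> R).
    by apply: measurable_indic; exact: measurable_arc.
  have bi (z : circle) : `|\1_(arc m k) z : R| <= 1.
    by rewrite indicE; case: (_ \in _); rewrite ?normr1 ?normr0.
  have comm (z : circle) : cpow p (cpow q z) = cpow q (cpow p z).
    by rewrite !cpowM mulnC.
  have := cvg_square_avg (@measurable_cpow R p) (@measurable_cpow R q)
    (fun A mA => (inv A mA).1) (fun A mA => (inv A mA).2) comm erg mi bi.
  by apply: filterS => a; split => //; exists 1.
have := ae_foralln (fun m => ae_foralln (H m)).
by apply: filterS => a aH; apply: generic_point_arcs => m k; exact: aH.
Qed.

(** There are countably many rational points, and [unpickle] enumerates them; each is
a null set. *)
Lemma ae_not_rational_point mu : continuous_measure mu ->
  {ae mu, forall a, ~ rational_point a}.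
Proof.
move=> cmu.
have H n : {ae mu, forall a : circle,
    a <> cexp (ratr (odflt 0 (unpickle n : option rat)))}.
  set b := cexp _; exists [set b]; split; [exact: measurable_circle_set1|exact: cmu|].
  by move=> a /= /contrapT.
apply: filterS (ae_foralln H) => a an [x [_ [r _ rx] ax]].
by apply: (an (pickle r)); rewrite pickleK /= rx.
Qed.

Lemma ae_exists mu (P : set circle) : {ae mu, forall a, P a} -> exists a, P a.
Proof.
move=> [N [mN N0 PN]]; apply: contrapT => /forallNP nP.
have NT : N = setT by apply/seteqP; split => // a _; apply: PN; exact: nP.
by move: N0; rewrite NT probability_setT => /eqP; rewrite onee_eq0.
Qed.

Theorem exists_irrational_generic p q mu :
  times_invariant p q mu -> times_ergodic p q mu -> continuous_measure mu ->
  exists x : R, [/\ x \in `[0, 1[, irrational x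
    & weak_star_cvg (orbit_measure p q x) mu].
Proof.
move=> inv erg cmu.
have [a [ga ra]] :=
  ae_exists (filterI (ae_generic_point inv erg) (ae_not_rational_point cmu)).
have [x x01 ax] := cexp_surj a; exists x; split => //.
  by move=> rx; apply: ra; exists x.
by apply: generic_point_weak_star; rewrite -ax.
Qed.

End generic_points.

(** * Averages of eventually periodic sequences *)

Section eventually_periodic.
Variable R : realType.

Lemma sum_shift_period (V : nmodType) (u : nat -> V) P : u P.+1 = u 0%N ->
  \sum_(i < P.+1) u i.+1 = \sum_(i < P.+1) u i.
Proof. by move=> uP; rewrite big_ord_recr big_ord_recl /= uP addrC. Qed.

Lemma sum_period_window (u : nat -> R) (I P n : nat) :
  (forall i, (I <= i)%N -> u (i + P.+1)%N = u i) -> (I <= n)%N ->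
  \sum_(i < P.+1) u (n + i)%N = \sum_(i < P.+1) u (I + i)%N.
Proof.
move=> per /subnKC <-; elim: (n - I)%N => [|k IH]; first by rewrite addn0.
rewrite -IH -[RHS](@sum_shift_period _ (fun i => u (I + k + i)%N)).
  by apply: eq_bigr => i _; rewrite addnS addSnnS.
by rewrite addn0 per// leq_addr.
Qed.

(** With [c] the mean over a period, the difference [\sum_(i < N) u i - N c] does not
change when [N >= I] grows by a period, so it is bounded by its values for
[N < I + P + 1].  The period is [P.+1] to be positive. *)
Lemma sum_eventually_periodic (u : nat -> R) (I P : nat) (B : R) :
  (forall i, `|u i| <= B) ->
  (forall i, (I <= i)%N -> u (i + P.+1)%N = u i) ->
  forall N, `|\sum_(i < N) u i - N%:R * (P.+1%:R^-1 * \sum_(i < P.+1) u (I + i)%N)|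
    <= (I + P.+1)%:R * (B + B).
Proof.
move=> uB per.
set c := _^-1 * _; have P0 : P.+1%:R != 0 :> R by rewrite pnatr_eq0.
have B0 : 0 <= B by apply: le_trans (uB 0%N).
have sumB (v : nat -> R) n : (forall i, `|v i| <= B) ->
    `|\sum_(i < n) v i| <= n%:R * B.
  move=> vB; rewrite (le_trans (ler_norm_sum _ _ _))//.
  apply: le_trans (ler_sum _ (fun (i : 'I_n) _ => vB i)) _.
  by rewrite sumr_const card_ord mulr_natl.
have cB : `|c| <= B.
  rewrite /c normrM ger0_norm ?invr_ge0// ler_pdivrMl ?ltr0n//.
  exact: (sumB (fun i => u (I + i)%N)).
elim/ltn_ind => N IH; have [NI|] := ltnP N (I + P.+1).
  rewrite (le_trans (ler_normB _ _))// mulrDr lerD//.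
    by rewrite (le_trans (sumB _ _ uB))// ler_wpM2r// ler_nat ltnW.
  by rewrite normrM ger0_norm// ler_pM// ler_nat ltnW.
move=> IN; have [k Nk] : exists k, N = (k + P.+1)%N.
  by exists (N - P.+1)%N; rewrite subnK// (leq_trans _ IN)// leq_addl.
move: IN IH; rewrite {N}Nk leq_add2r => Ik IH.
rewrite big_split_ord /= (sum_period_window per Ik).
have -> : \sum_(i < P.+1) u (I + i)%N = P.+1%:R * c by rewrite /c mulVKf.
rewrite natrD mulrDl opprD addrACA subrr addr0; apply: IH.
by rewrite addnS ltnS leq_addr.
Qed.

(** The one-dimensional estimate, applied first to the inner sums and then to their
means over a period, leaves an error of order [N] against [N ^ 2]. *)
Lemma double_sum_eventually_periodic (u : nat -> nat -> R) (I J P Q : nat) (B : R) :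
  (forall i j, `|u i j| <= B) ->
  (forall i j, (I <= i)%N -> u (i + P.+1)%N j = u i j) ->
  (forall i j, (J <= j)%N -> u i (j + Q.+1)%N = u i j) ->
  (N%:R ^+ 2)^-1 * (\sum_(i < N) \sum_(j < N) u i j) @[N --> \oo] -->
  (P.+1%:R * Q.+1%:R)^-1 *
    \sum_(i < P.+1) \sum_(j < Q.+1) u (I + i)%N (J + j)%N.
Proof.
move=> uB perP perQ; have B0 : 0 <= B by apply: le_trans (uB 0%N 0%N).
pose c i := Q.+1%:R^-1 * \sum_(j < Q.+1) u i (J + j)%N.
have cB i : `|c i| <= B.
  rewrite /c normrM ger0_norm ?invr_ge0// ler_pdivrMl ?ltr0n//.
  rewrite (le_trans (ler_norm_sum _ _ _))//.
  apply: le_trans (ler_sum _ (fun (j : 'I_Q.+1) _ => uB i (J + j)%N)) _.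
  by rewrite sumr_const card_ord mulr_natl.
have cper i : (I <= i)%N -> c (i + P.+1)%N = c i.
  by move=> Ii; congr (_ * _); apply: eq_bigr => j _; exact: perP.
set C := (X in _ --> X).
have CE : C = P.+1%:R^-1 * \sum_(i < P.+1) c (I + i)%N.
  by rewrite /C /c -mulr_sumr mulrA invfM.
pose K := (J + Q.+1)%:R * (B + B) + (I + P.+1)%:R * (B + B).
apply/subr_cvg0; apply: (@cvg_le_harmonic _ _ K) => N N0.
have n0 : 0 < N%:R :> R by rewrite ltr0n.
have inner : `|\sum_(i < N) \sum_(j < N) u i j - N%:R * \sum_(i < N) c i| <=
    N%:R * ((J + Q.+1)%:R * (B + B)).
  rewrite mulr_sumr -sumrB (le_trans (ler_norm_sum _ _ _))//.
  apply: le_trans (ler_sum _ (fun (i : 'I_N) _ =>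
    sum_eventually_periodic (uB i) (perQ i) N)) _.
  by rewrite sumr_const card_ord -[leLHS]mulr_natl.
have outer := sum_eventually_periodic cB cper N; rewrite -CE in outer.
have -> : (N%:R ^+ 2)^-1 * (\sum_(i < N) \sum_(j < N) u i j) - C =
    (N%:R ^+ 2)^-1 * ((\sum_(i < N) \sum_(j < N) u i j - N%:R * \sum_(i < N) c i)
      + N%:R * (\sum_(i < N) c i - N%:R * C)).
  by field; rewrite gt_eqF.
rewrite normrM gtr0_norm ?invr_gt0 ?exprn_gt0// ler_pdivrMl ?exprn_gt0//.
have -> : N%:R ^+ 2 * (K / N%:R) = N%:R * K by field; rewrite gt_eqF.
rewrite (le_trans (ler_normD _ _))// /K [leRHS]mulrDr lerD//.
by rewrite normrM gtr0_norm// ler_pM2l.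
Qed.

End eventually_periodic.

(** By the pigeonhole principle two of the first [n + 1] powers agree modulo [n], and
a coincidence propagates to all larger exponents. *)
Lemma expn_eventually_periodic (p n : nat) : (0 < n)%N ->
  exists I P, forall i, (I <= i)%N -> p ^ (i + P.+1) = p ^ i %[mod n].
Proof.
move=> n0; pose f (i : 'I_n.+1) := Ordinal (ltn_pmod (p ^ i) n0).
have /injectivePn[i [j ij fij]] : ~~ injectiveb f.
  by apply/negP => /injectiveP/leq_card; rewrite !card_ord ltnn.
wlog lt_ij : i j ij fij / (i < j)%N.
  move=> H; have [|ji|/val_inj eij] := ltngtP i j; first exact: H fij.
    by apply: (H j i) => //; rewrite eq_sym.
  by rewrite eij eqxx in ij.
exists (i : nat), (j - i).-1 => k ik.
rewrite prednK ?subn_gt0// addnBA ?(ltnW lt_ij)//.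
rewrite addnC -addnBA// expnD -[in RHS](subnKC ik) expnD.
have eqf : p ^ i = p ^ j %[mod n] by move/(congr1 val): fij.
by rewrite -modnMml -eqf modnMml.
Qed.

(** * Rational points *)

Section periodic_measure.
Context d (T : measurableType d) (R : realType) (z : nat -> nat -> T) (P Q : nat).

(** The sides are [P.+1] and [Q.+1] so that the box is never empty and the total mass
is 1 for every [z], [P] and [Q]. *)
Definition box_measure : set T -> \bar R :=
  mscale ((P.+1%:R * Q.+1%:R)^-1)%:nng
    (msum (fun i => msum (fun j => \d_(z i j)) Q.+1) P.+1).

HB.instance Definition _ := Measure.on box_measure.

Lemma box_measureE A : box_measure A =
  (((P.+1%:R * Q.+1%:R)^-1)%:E *
    \sum_(i < P.+1) \sum_(j < Q.+1) \d_(z i j) A)%E.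
Proof. by []. Qed.

Lemma box_measure_full A : (forall i j, (i <= P)%N -> (j <= Q)%N -> A (z i j)) ->
  box_measure A = 1%E.
Proof.
move=> Az; rewrite box_measureE.
have -> : (\sum_(i < P.+1) \sum_(j < Q.+1) \d_(z i j) A)%E =
    (P.+1%:R * Q.+1%:R : R)%:E.
  transitivity (\sum_(i < P.+1) \sum_(j < Q.+1) 1%:E : \bar R)%E.
    apply: eq_bigr => i _; apply: eq_bigr => j _.
    by rewrite diracE mem_set//; apply: Az; rewrite -ltnS ltn_ord.
  under eq_bigr do rewrite sumEFin sumr_const card_ord.
  by rewrite sumEFin sumr_const card_ord -natrM -mulrnA mulnC.
by rewrite -EFinM mulVf// mulf_neq0// pnatr_eq0.
Qed.

Lemma box_measure_setT : box_measure setT = 1%E.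
Proof. exact: box_measure_full. Qed.

HB.instance Definition _ :=
  Measure_isProbability.Build _ _ _ box_measure box_measure_setT.

End periodic_measure.

Section rational_points.
Variable R : realType.
Local Notation circle := (circle R).

(** A rational angle [k / n] gives [a ^ n = cexp k = 1].  The quotient supplied by
[rationalP] may have denominator [0], in which case the angle is [0]; a negative
numerator is excluded by the range of the angle. *)
Lemma rational_point_torsion (a : circle) : rational_point a ->
  exists2 n, (0 < n)%N & cval a ^+ n = 1.
Proof.
move=> [x [+ /rationalP[k [n xkn]] ->]]; rewrite in_itv /= => /andP[x0 _].
have e1 : cval (@cexp R 1) = 1.
  rewrite /= mulr1; have -> : 2 * pi = pi *+ 2 :> R by rewrite mulr_natl.
  by rewrite cos2pi sin2pi.
have [n0|n0] := posnP n.
  exists 1%N => //; have -> : x = 0 by rewrite xkn n0 invr0 mulr0.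
  by rewrite expr1 /= mulr0 cos0 sin0.
exists n => //.
rewrite -[LHS]/(cval (cpow n (cexp x))) cpow_cexp.
have n0' : n%:R != 0 :> R by rewrite pnatr_eq0 -lt0n.
have -> : n%:R * x = k%:~R by rewrite xkn mulrC divfK.
case: k xkn => k xkn.
  have -> : (Posz k)%:~R = k%:R * 1 :> R by rewrite mulr1.
  by rewrite -cpow_cexp -[LHS]/(cval (cexp 1) ^+ k) e1 expr1n.
have : x < 0.
  by rewrite xkn pmulr_llt0 ?invr_gt0 ?ltr0n// ltrz0.
by rewrite ltNge x0.
Qed.

Lemma cpow_modn (a : circle) n i j : cval a ^+ n = 1 -> i = j %[mod n] ->
  cpow i a = cpow j a.
Proof.
by move=> an ij; apply: val_inj; rewrite /= -(expr_mod i an) ij expr_mod.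
Qed.

Theorem rational_point_generic p q (a : circle) : rational_point a ->
  exists nu : probability circle R,
    [/\ finitely_supported nu, times_invariant p q nu, times_ergodic p q nu
      & generic_point p q a nu].
Proof.
move=> /rational_point_torsion[n n0 an].
have [I [P perP]] := expn_eventually_periodic p n0.
have [J [Q perQ]] := expn_eventually_periodic q n0.
pose F i j : circle := cpow (p ^ i * q ^ j) a.
have FP i j : (I <= i)%N -> F (i + P.+1)%N j = F i j.
  by move=> Ii; apply: cpow_modn an _; rewrite -modnMml perP// modnMml.
have FQ i j : (J <= j)%N -> F i (j + Q.+1)%N = F i j.
  by move=> Jj; apply: cpow_modn an _; rewrite -modnMmr perQ// modnMmr.
have Fp i j : cpow p (F i j) = F i.+1 j.
  by rewrite /F cpowM mulnAC -expnSr.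
have Fq i j : cpow q (F i j) = F i j.+1.
  by rewrite /F cpowM -mulnA -expnSr.
pose z i j := F (I + i)%N (J + j)%N.
exists (box_measure R z P Q); split.
- exists [set z i j | i in `I_P.+1 & j in `I_Q.+1].
    by apply: finite_image2; exact: finite_II.
  by apply: box_measure_full => i j iP jQ; exists i => //; exists j.
- move=> A mA; rewrite /= !box_measureE; split; congr (_ * _)%E.
    transitivity (\sum_(i < P.+1) \sum_(j < Q.+1) \d_(z i.+1 j) A : \bar R)%E.
      apply: eq_bigr => i _; apply: eq_bigr => j _.
      by rewrite !diracE /z addnS -Fp.
    apply: (@sum_shift_period _ (fun i => \sum_(j < Q.+1) \d_(z i j) A)%E).
    by apply: eq_bigr => j _; rewrite /z addn0 FP.
  apply: eq_bigr => i _.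
  transitivity (\sum_(j < Q.+1) \d_(z i j.+1) A : \bar R)%E.
    by apply: eq_bigr => j _; rewrite !diracE /z addnS -Fq.
  apply: (@sum_shift_period _ (fun j => \d_(z i j) A)%E).
  by rewrite /z addn0 FQ.
- move=> A mA pA qA.
  (* Every point of the orbit lies in [A] exactly when [a] does. *)
  have FA i j : A (F i j) <-> A a.
    elim: i j => [|i IH] j.
      elim: j => [|j IH].
        rewrite (_ : F 0 0 = a)//; apply: val_inj.
        by rewrite /= !expn0 muln1 expr1.
      by rewrite -Fq -[A (cpow q _)]/((cpow q @^-1` A) _) qA.
    by rewrite -Fp -[A (cpow p _)]/((cpow p @^-1` A) _) pA.
  have [Aa|nAa] := pselect (A a); [right|left].
    by apply: box_measure_full => i j _ _; exact/FA.
  rewrite /= box_measureE big1 ?mule0// => i _; rewrite big1// => j _.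
  by rewrite diracE memNset//; move/FA.
- apply: generic_point_real => g cg; under eq_fun do rewrite square_avg_cpow.
  rewrite Rintegral_dirac_average /=; last exact: continuous_circle_measurable.
  apply: (@double_sum_eventually_periodic _ (fun i j => g (F i j)) _ _ _ _
    (\sum_(k < n) `|g (cpow k a)|)).
  (* The orbit consists of powers [a ^ k] with [k < n], so [g] is bounded on it. *)
  + move=> i j; pose k := Ordinal (ltn_pmod (p ^ i * q ^ j) n0).
    rewrite (_ : F i j = cpow k a); last by apply: (cpow_modn an); rewrite modn_mod.
    by rewrite (bigD1 k) //= lerDl sumr_ge0.
  + by move=> i j Ii; rewrite FP.
  + by move=> i j Jj; rewrite FQ.
Qed.

End rational_points.

Theorem theorem3p7 (R : realType) (p q : nat) (hp : (0 < p)%N) (hq : (0 < q)%N)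
    (hpq : irrational (ln (p%:R : R) / ln (q%:R : R))) :
  (forall a : circle R, rational_point a ->
     exists nu : probability (circle R) R,
       [/\ finitely_supported nu, times_invariant p q nu, times_ergodic p q nu
         & generic_point p q a nu])
  /\
  (forall mu : probability (circle R) R,
     times_invariant p q mu -> times_ergodic p q mu -> continuous_measure mu ->
     exists x : R,
       [/\ x \in `[0, 1[, irrational x
         & weak_star_cvg (orbit_measure p q x) mu]).
Proof.
split=> [a|mu]; first exact: rational_point_generic.
exact: exists_irrational_generic.
Qed.
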